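(* Let $\mathscr{A}\in\mathbb{C}^{n\times n\times p}$ and let $[\lambda]$ be an arbitrary tubular eigenvalue of $\mathscr{A}$. If $F_p$ is the DFT matrix of order $p$ and $$F_p^H\,\mathrm{circ}([\lambda])\,F_p=\mathrm{diag}(\tilde\lambda_1,\tilde\lambda_2,\ldots,\tilde\lambda_p),$$ then $\tilde\lambda_1,\tilde\lambda_2,\ldots,\tilde\lambda_p$ are T-eigenvalues of $\mathscr{A}$.
   Context: For a tensor $\mathscr{X}\in\mathbb{C}^{n\times m\times p}$, $X_k\in\mathbb{C}^{n\times m}$ ($k=1,\dots,p$) denotes the $k$-th frontal slice. $\mathrm{Unfold}(\mathscr{X})\in\mathbb{C}^{np\times m}$ stacks $X_1,\dots,X_p$ vertically, and $\mathrm{Fold}$ is its inverse. $\mathrm{bcirc}(\mathscr{X})\in\mathbb{C}^{np\times mp}$ is the block-circulant matrix whose $(i,j)$ block is $X_{((i-j)\bmod p)+1}$. The T-product of $\mathscr{X}\in\mathbb{C}^{n\times m\times p}$ and $\mathscr{Y}\in\mathbb{C}^{m\times\ell\times p}$ is $\mathscr{X}*\mathscr{Y}=\mathrm{Fold}(\mathrm{bcirc}(\mathscr{X})\,\mathrm{Unfold}(\mathscr{Y}))$. The conjugate transpose $\mathscr{X}^H$ is the tensor with $\mathrm{bcirc}(\mathscr{X}^H)=\mathrm{bcirc}(\mathscr{X})^H$. A tubular tensor of length $p$ is a $1\times1\times p$ tensor; for $v\in\mathbb{C}^p$, $[v]$ is the tubular tensor with $[v]_{11j}=v_j$, and $\mathrm{circ}([v])$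 is the $p\times p$ circulant matrix with $(i,j)$ entry $v_{((i-j)\bmod p)+1}$. An $n\times n\times p$ tensor is non-singular if its $\mathrm{bcirc}$ is a non-singular matrix (equivalently, it is invertible for $*$). $F_p$ is the $p\times p$ matrix with $(j,k)$ entry $p^{-1/2}\omega^{(j-1)(k-1)}$, $\omega=e^{-2\pi\mathbf{i}/p}$; it is unitary and $F_p^H\mathrm{circ}([v])F_p$ is diagonal for every $v$. T-eigenvalue: a scalar $\lambda\in\mathbb{C}$ is a T-eigenvalue of $\mathscr{A}$ if $\mathscr{A}*\mathscr{X}=\lambda\mathscr{X}$ for some nonzero $\mathscr{X}\in\mathbb{C}^{n\times1\times p}$. Tubular eigenvalue: a tubular tensor $[\lambda]$ of length $p$ is a tubular eigenvalue of $\mathscr{A}\in\mathbb{C}^{n\times n\times p}$ if there is $\mathscr{X}\in\mathbb{C}^{n\times1\times p}$ (an eigentensor) such that $\mathscr{A}*\mathscr{X}=\mathscr{X}*[\lambda]$ and the tubular tensor $\mathscr{X}^H*\mathscr{X}$ is non-singular. *)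

(* Defs.v *)
From mathcomp Require Import all_boot all_order all_algebra.
From mathcomp Require Import spectral sesquilinear complex.
From mathcomp Require Import reals trigo.
From mathcomp Require Import zify.

Set Implicit Arguments.
Unset Strict Implicit.
Unset Printing Implicit Defensive.

Import Order.TTheory GRing.Theory Num.Theory.

Local Open Scope ring_scope.
Local Open Scope complex_scope.
Local Open Scope sesquilinear_scope.

(* Third-order tensors in K^(n x m x p) are given by their p frontal slices.
   Indices start at 0, so the slice X_k of the usual notation is [X k] with k
   shifted down by one. *)
Definition tensor (K : Type) (n m p : nat) := {ffun 'I_p -> 'M[K]_(n, m)}.

Lemma ord_subm_proof p (i j : 'I_p) : ((i + (p - j)) %% p < p)%N.
Proof. by rewrite ltn_mod (leq_ltn_trans (leq0n i)). Qed.

(* (i - j) mod p; subtraction is the truncated one of nat, whence the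
   form i + (p - j). *)
Definition ord_subm p (i j : 'I_p) : 'I_p := Ordinal (ord_subm_proof i j).

Lemma ord_oppm_proof p (i : 'I_p) : ((p - i) %% p < p)%N.
Proof. by rewrite ltn_mod (leq_ltn_trans (leq0n i)). Qed.

Definition ord_oppm p (i : 'I_p) : 'I_p := Ordinal (ord_oppm_proof i).

Definition unfold_tensor (K : Type) n m p (X : tensor K n m p)
  : 'M[K]_(\sum_(k < p) n, m) := \mxcol_(k < p) X k.

Definition fold_tensor (K : Type) n m p (B : 'M[K]_(\sum_(k < p) n, m))
  : tensor K n m p := [ffun k => submxcol B k].

Definition bcirc (K : Type) n m p (X : tensor K n m p)
  : 'M[K]_(\sum_(i < p) n, \sum_(j < p) m) :=
  \mxblock_(i < p, j < p) X (ord_subm i j).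

Definition tprod (K : nzRingType) n m l p
    (X : tensor K n m p) (Y : tensor K m l p) : tensor K n l p :=
  fold_tensor (bcirc X *m unfold_tensor Y).

(* The unique tensor whose [bcirc] is the conjugate transpose of [bcirc X], see
   [bcirc_ctrtensor] and [bcirc_inj] below. *)
Definition ctrtensor (C : numClosedFieldType) n m p (X : tensor C n m p)
  : tensor C m n p := [ffun k => (X (ord_oppm k))^t*].

Definition tube (K : Type) p (v : 'rV[K]_p) : tensor K 1 1 p :=
  [ffun k => const_mx (v 0 k)].

Definition circ (K : Type) p (t : tensor K 1 1 p) : 'M[K]_p :=
  \matrix_(i, j) t (ord_subm i j) 0 0.

Definition tensor_nonsingular (K : comUnitRingType) n p (X : tensor K n n p) :=
  bcirc X \in unitmx.

Definition T_eigenvalue (K : nzRingType) n p (A : tensor K n n p) (a : K) :=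
  exists X : tensor K n 1 p, X != 0 /\ tprod A X = a *: X.

Definition tubular_eigenvalue (C : numClosedFieldType) n p
    (A : tensor C n n p) (t : tensor C 1 1 p) :=
  exists X : tensor C n 1 p,
    tprod A X = tprod X t /\ tensor_nonsingular (tprod (ctrtensor X) X).

(* exp(-2 pi i / p), in trigonometric form *)
Definition dft_root (R : realType) (p : nat) : R[i] :=
  let theta := - (2 * pi / p%:R) in cos theta +i* sin theta.

Definition dft (R : realType) (p : nat) : 'M[R[i]]_p :=
  \matrix_(j, k) ((sqrtC p%:R)^-1 * dft_root R p ^+ (j * k)).

Lemma bcirc_inj (K : Type) n m p : injective (@bcirc K n m p).
Proof.
move=> X Y; rewrite /bcirc => eqXY.
have eqb := iffRL (eq_mxblockP _ _) eqXY.
apply/ffunP => k.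
have p_gt0 : (0 < p)%N by apply: leq_ltn_trans (ltn_ord k).
have := eqb k (Ordinal p_gt0).
suff -> : ord_subm k (Ordinal p_gt0) = k by [].
by apply: val_inj; rewrite /= subn0 modnDr modn_small.
Qed.

Lemma ord_oppm_sub p (i j : 'I_p) : ord_oppm (ord_subm i j) = ord_subm j i.
Proof.
apply: val_inj => /=.
have lti := ltn_ord i; have ltj := ltn_ord j.
have [le_ji|lt_ij] := leqP j i.
  have -> : (i + (p - j) = (i - j) + p)%N by rewrite addnBA 1?ltnW // addnBAC.
  rewrite modnDr (modn_small (leq_ltn_trans (leq_subr _ _) lti)).
  by congr (_ %% _)%N; lia.
have -> : ((i + (p - j)) %% p = i + (p - j))%N by rewrite modn_small //; lia.
have -> : (j + (p - i) = (j - i) + p)%N by lia.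
by rewrite modnDr; congr (_ %% _)%N; lia.
Qed.

Lemma bcirc_ctrtensor (C : numClosedFieldType) n m p (X : tensor C n m p) :
  bcirc (ctrtensor X) = (bcirc X)^t*.
Proof.
rewrite /bcirc tr_mxblock; apply/matrixP => i j.
by rewrite !mxE ffunE ord_oppm_sub !mxE.
Qed.

(* Main.v *)
Require Import Defs.
From mathcomp Require Import all_boot all_order all_algebra.
From mathcomp Require Import spectral sesquilinear complex.
From mathcomp Require Import reals trigo.

Set Implicit Arguments.
Unset Strict Implicit.
Unset Printing Implicit Defensive.

Import Order.TTheory GRing.Theory Num.Theory.

Local Open Scope ring_scope.
Local Open Scope complex_scope.
Local Open Scope sesquilinear_scope.

(** Right multiplication by a tube [v] turns the tubular eigen-equation
    [A * X = X * t] into [A * (X * v) = X * (t * v)].  The slices of [t * v] are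
    the entries of [circ t] applied to [v]; so, when [v] is an eigenvector of
    [circ t] for [mu], the tensor [X * v] satisfies [A * (X * v) = mu (X * v)].
    It is nonzero when [v] is: from [X * v = 0] follows [(X^H * X) * v = 0], and
    [X^H * X] is non-singular.  Hence every eigenvalue of [circ t] is a
    T-eigenvalue of [A] ([T_eigenvalue_of_circ]).

    The columns of the DFT matrix are such eigenvectors, because a vector of
    powers of a p-th root of unity is an eigenvector of every circulant matrix
    ([circ_powers]).  They have Euclidean norm 1, so the k-th diagonal entry of
    [F^H (circ t) F] is the eigenvalue of [circ t] at the k-th column.  Only the
    norms of the columns matter here, not their mutual orthogonality. *)

Lemma ord_subm_sub p (i j : 'I_p.+1) : ord_subm i j = i - j.
Proof. by apply: val_inj; rewrite /= modnDmr. Qed.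

Lemma ord_subm_inj p (j : 'I_p) : injective (fun i => ord_subm i j).
Proof.
case: p j => [[]//|p] j i1 i2; rewrite !ord_subm_sub; exact: subIr.
Qed.

Lemma ord_subm_injr p (i : 'I_p) : injective (ord_subm i).
Proof.
by case: p i => [[]//|p] i j1 j2; rewrite !ord_subm_sub => /addrI /oppr_inj.
Qed.

Lemma ord_submK p (i : 'I_p) : involutive (ord_subm i).
Proof. by case: p i => [[]//|p] i j; rewrite !ord_subm_sub subKr. Qed.

Lemma ord_subm_subm p (k l j : 'I_p) :
  ord_subm (ord_subm k j) (ord_subm l j) = ord_subm k l.
Proof.
by case: p k l j => [[]//|p] k l j; rewrite !ord_subm_sub opprB addrA subrK.
Qed.

Lemma tprodE (K : nzRingType) n m l p (X : tensor K n m p) (Y : tensor K m l p)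
    (k : 'I_p) :
  tprod X Y k = \sum_j X (ord_subm k j) *m Y j.
Proof. by rewrite ffunE mul_mxblock_mxrow mxcolK. Qed.

Lemma tprodA (K : nzRingType) n m l q p (X : tensor K n m p)
    (Y : tensor K m l p) (Z : tensor K l q p) :
  tprod X (tprod Y Z) = tprod (tprod X Y) Z.
Proof.
apply/ffunP => k; rewrite !tprodE.
under eq_bigr => i _ do rewrite tprodE mulmx_sumr.
rewrite exchange_big; apply: eq_bigr => j _.
rewrite tprodE mulmx_suml [RHS](reindex_inj (@ord_subm_inj _ j)) /=.
by apply: eq_bigr => i _; rewrite ord_subm_subm mulmxA.
Qed.

Lemma tprod0 (K : nzRingType) n m l p (X : tensor K n m p) :
  tprod X (0 : tensor K m l p) = 0.
Proof.
apply/ffunP => k; rewrite tprodE ffunE big1 // => j _.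
by rewrite ffunE mulmx0.
Qed.

Lemma tprodZr (K : comNzRingType) n m l p (X : tensor K n m p) a
    (Y : tensor K m l p) :
  tprod X (a *: Y) = a *: tprod X Y.
Proof.
apply/ffunP => k; transitivity (a *: tprod X Y k); last by rewrite [RHS]ffunE.
rewrite !tprodE scaler_sumr.
by apply: eq_bigr => j _; rewrite ffunE scalemxAr.
Qed.

Lemma tensor_nonsingular_eq0 (K : comUnitRingType) n l p (G : tensor K n n p)
    (Y : tensor K n l p) :
  tensor_nonsingular G -> tprod G Y = 0 -> Y = 0.
Proof.
move=> Gu GY0.
have bY0 : bcirc G *m unfold_tensor Y = 0.
  rewrite -[LHS]submxcolK -[RHS]mxcol0; apply/eq_mxcolP => k.
  by move/ffunP/(_ k): GY0; rewrite !ffunE.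
have Y0 : unfold_tensor Y = 0 by rewrite -[LHS](mulKmx Gu) bY0 mulmx0.
apply/ffunP => k; rewrite ffunE -[LHS](mxcolK Y) -/(unfold_tensor Y) Y0.
by rewrite -[0]mxcol0 mxcolK.
Qed.

Lemma tprod_tube (K : nzRingType) p (t : tensor K 1 1 p) (v : 'cV[K]_p) :
  tprod t (tube v^T) = tube (circ t *m v)^T.
Proof.
apply/ffunP => k; rewrite tprodE ffunE; apply/matrixP => i j.
rewrite !ord1 summxE !mxE; apply: eq_bigr => l _.
by rewrite !mxE big_ord1 ffunE !mxE.
Qed.

Lemma T_eigenvalue_of_circ (C : numClosedFieldType) n p (A : tensor C n n p)
    (t : tensor C 1 1 p) (v : 'cV[C]_p) (mu : C) :
  tubular_eigenvalue A t -> v != 0 -> circ t *m v = mu *: v ->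
  T_eigenvalue A mu.
Proof.
move=> [X [AX XXu]] v_neq0 tv; exists (tprod X (tube v^T)); split.
  apply: contraNneq v_neq0 => Xv0.
  have : tprod (tprod (ctrtensor X) X) (tube v^T) = 0.
    by rewrite -tprodA Xv0 tprod0.
  move/(tensor_nonsingular_eq0 XXu)/ffunP => v0.
  apply/eqP/matrixP => k j; move/matrixP/(_ 0 0): (v0 k).
  by rewrite !ffunE !mxE ord1.
rewrite tprodA AX -tprodA tprod_tube tv -tprodZr; congr tprod.
by apply/ffunP => k; rewrite !ffunE; apply/matrixP => i j; rewrite !mxE.
Qed.

(** The eigenvalue is the sum of the [t_m w^(-m)], the exponent being taken
    modulo the order of the matrix. *)
Lemma circ_powers (K : comNzRingType) p (t : tensor K 1 1 p) (w : K) :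
  w ^+ p = 1 ->
  circ t *m (\col_j w ^+ j) =
    (\sum_m t m 0 0 * w ^+ ord_oppm m) *: \col_j w ^+ j.
Proof.
move=> wp1; apply/matrixP => i j; rewrite !mxE mulr_suml.
(* The column index is j = i - m modulo p, so that w^j = w^i w^(-m). *)
rewrite (reindex_inj (@ord_subm_injr _ i)) /=; apply: eq_bigr => m _.
rewrite !mxE ord_submK -mulrA; congr (_ * _).
by rewrite !expr_mod // addnC exprD.
Qed.

Lemma cos_sinX (R : realType) (x : R) n :
  (cos x +i* sin x) ^+ n = cos (x *+ n) +i* sin (x *+ n).
Proof.
elim: n => [|n IHn]; first by rewrite !mulr0n cos0 sin0.
rewrite exprS IHn mulrS cosD sinD [LHS]/GRing.mul /=.
by rewrite [cos x * sin _ + _]addrC.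
Qed.

Lemma dft_root_unity (R : realType) p : (0 < p)%N -> dft_root R p ^+ p = 1.
Proof.
move=> p_gt0; rewrite /dft_root cos_sinX.
have -> : - (2 * pi / p%:R) *+ p = - (pi *+ 2) :> R.
  by rewrite mulNrn -[X in - X = _]mulr_natr mulfVK ?mulr_natl // pnatr_eq0 -lt0n.
by rewrite cosN sinN cos2pi sin2pi oppr0.
Qed.

Lemma norm_dft_root (R : realType) p : (0 < p)%N -> `|dft_root R p| = 1.
Proof.
move=> p_gt0; apply/eqP; rewrite -(@pexpr_eq1 _ _ p) //.
by rewrite -normrX dft_root_unity // normr1.
Qed.

Lemma col_dft (R : realType) p (k : 'I_p) :
  col k (dft R p) = (sqrtC p%:R)^-1 *: \col_j (dft_root R p ^+ k) ^+ j.
Proof. by apply/matrixP => i j; rewrite !mxE mulnC exprM. Qed.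

Lemma circ_col_dft (R : realType) p (t : tensor R[i] 1 1 p) (k : 'I_p) :
  exists mu, circ t *m col k (dft R p) = mu *: col k (dft R p).
Proof.
have p_gt0 : (0 < p)%N by apply: leq_ltn_trans (ltn_ord k).
have wk1 : (dft_root R p ^+ k) ^+ p = 1.
  by rewrite exprAC dft_root_unity // expr1n.
exists (\sum_m t m 0 0 * (dft_root R p ^+ k) ^+ ord_oppm m).
by rewrite col_dft -scalemxAr (circ_powers _ wk1) !scalerA mulrC.
Qed.

Lemma col_dft_norm (R : realType) p (k : 'I_p) :
  (col k (dft R p))^t* *m col k (dft R p) = 1%:M.
Proof.
have p_gt0 : (0 < p)%N by apply: leq_ltn_trans (ltn_ord k).
apply/matrixP => i j; rewrite !ord1 !mxE.
under eq_bigr => l _.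
  (* Each summand is |F_lk|^2 = 1/p, since the root of unity has modulus 1. *)
  rewrite !mxE -normCKC normrM normrX norm_dft_root // expr1n mulr1.
  rewrite normfV ger0_norm ?sqrtC_ge0 ?ler0n // exprVn sqrtCK.
over.
rewrite sumr_const card_ord -[LHS]mulr_natl divff //.
by rewrite pnatr_eq0 -lt0n.
Qed.

Theorem theorem2p10 (R : realType) (n p : nat) (A : tensor R[i] n n p)
    (lam : 'rV[R[i]]_p) (tlam : 'rV[R[i]]_p) :
  tubular_eigenvalue A (tube lam) ->
  (dft R p)^t* *m circ (tube lam) *m dft R p = diag_mx tlam ->
  forall k : 'I_p, T_eigenvalue A (tlam 0 k).
Proof.
move=> Alam diagF k.
set f := col k (dft R p).
have [mu Cf] := circ_col_dft (tube lam) k.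
have f1 := col_dft_norm R k.
have f_neq0 : f != 0.
  apply/eqP => f0; move: f1; rewrite -/f f0 mulmx0 => /matrixP/(_ 0 0)/eqP.
  by rewrite !mxE eq_sym oner_eq0.
suff -> : tlam 0 k = mu by apply: T_eigenvalue_of_circ Alam f_neq0 Cf.
(* The (k,k) entry of the diagonalization reads f^H (circ lam) f = tlam_k. *)
have : f^t* *m (circ (tube lam) *m f) = (tlam 0 k)%:M.
  transitivity (row k (col k (diag_mx tlam))).
    by rewrite -diagF -mulmxA [X in row k X]colE -[in RHS]mulmxA row_mul -mulmxA
      -colE /f tr_col map_row.
  by apply/matrixP => i j; rewrite !ord1 !mxE eqxx.
rewrite Cf -scalemxAr f1 => /matrixP/(_ 0 0).
by rewrite !mxE mulr1.
Qed.
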